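(* For any $\varepsilon\in(0,1)$, the second-order coding rate for the biometrical identification problem satisfies \begin{align} L^*(\varepsilon)=\sqrt{\mathrm{V}}\Phi^{-1}(\varepsilon). \end{align}
   Context: Biometrical identification problem: $\mathcal{X},\mathcal{Y},\mathcal{Z}$ are finite alphabets; $M$ feature vectors $X^n(1),\ldots,X^n(M)$ are generated i.i.d. according to $P_X^n$; for each $m$, $Y^n(m)$ is the output of a DMC $P_{Y|X}$ with input $X^n(m)$ and is stored without compression. An index $W$ uniform on $\{1,\ldots,M\}$, independent of everything else, is drawn; the user observes $Z^n$, the output of a DMC $P_{Z|X}$ with input $X^n(W)$, and outputs $\hat{W}=g^{(n)}(Y^n(1),\ldots,Y^n(M),Z^n)$ for a deterministic decoding function $g^{(n)}$; the error probability is $\mathrm{P}_\mathrm{e}^{(n)}(g^{(n)})=\Pr\{\hat{W}\neq W\}$. Let $M^*(n,\varepsilon)$ be the maximum number of items such that $\min_{g^{(n)}}\mathrm{P}_\mathrm{e}^{(n)}(g^{(n)})\leq \varepsilon$, and $L^*(\varepsilon):=\liminf_{n\to\infty}\frac{1}{\sqrt{n}} \big(\log M^*(n,\varepsilon)-nI(P_Y,P_{Z|Y}) \big)$. Here $(Y,Z)\sim P_{YZ}$ induced by $P_X\times P_{Y|X}\times P_{Z|X}$, $\mathrm{V}:=\mathrm{Var}\left[\log\frac{P_{Z|Y}(Z|Y)}{P_Z(Z)}\right]>0$ is assumed, and $\Phi^{-1}$ is the inverse of the standard Gaussian cumulative distribution function. *)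

(* Defs.v *)
From HB Require Import structures.
From mathcomp Require Import all_boot all_order all_algebra.
From mathcomp Require Import all_classical all_reals all_analysis.
Set Implicit Arguments. Unset Strict Implicit. Unset Printing Implicit Defensive.
Import Order.TTheory GRing.Theory Num.Theory.
Local Open Scope classical_set_scope.
Local Open Scope ring_scope.

Section Biometric.
Variable R : realType.

Definition is_dist (T : finType) (P : T -> R) :=
  (forall t, 0 <= P t) /\ \sum_(t : T) P t = 1.

Definition is_channel (A B : finType) (W : A -> B -> R) :=
  forall a, is_dist (W a).

Variables (X Y Z : finType) (PX : X -> R) (PYgX : X -> Y -> R) (PZgX : X -> Z -> R).

Definition PYZ (y : Y) (z : Z) : R := \sum_(x : X) PX x * PYgX x y * PZgX x z.
Definition PY (y : Y) : R := \sum_(z : Z) PYZ y z.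
Definition PZ (z : Z) : R := \sum_(y : Y) PYZ y z.
Definition PZgY (y : Y) (z : Z) : R := PYZ y z / PY y.

Definition info_dens (y : Y) (z : Z) : R := ln (PZgY y z / PZ z).

Definition mutual_info : R :=
  \sum_(y : Y) \sum_(z : Z | 0 < PYZ y z) PYZ y z * info_dens y z.

Definition dispersion : R :=
  \sum_(y : Y) \sum_(z : Z | 0 < PYZ y z) PYZ y z * (info_dens y z - mutual_info) ^+ 2.

(* Error probability of decoder g with M items and blocklength n.
   xs m = X^n(m), ys m = Y^n(m), w = W, z = Z^n; W uniform on 'I_M. *)
Definition err_prob (n M : nat)
  (g : {ffun 'I_M -> {ffun 'I_n -> Y}} -> {ffun 'I_n -> Z} -> 'I_M) : R :=
  \sum_(xs : {ffun 'I_M -> {ffun 'I_n -> X}})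
  \sum_(ys : {ffun 'I_M -> {ffun 'I_n -> Y}})
  \sum_(w : 'I_M)
  \sum_(z : {ffun 'I_n -> Z})
    (M%:R)^-1 *
    (\prod_(m : 'I_M) \prod_(i : 'I_n) (PX (xs m i) * PYgX (xs m i) (ys m i))) *
    (\prod_(i : 'I_n) PZgX (xs w i) (z i)) *
    (if g ys z != w then 1 else 0).

Definition achievable (n : nat) (eps : R) (M : nat) : Prop :=
  (0 < M)%N /\ exists g, err_prob (n := n) (M := M) g <= eps.

(* M^*(n, eps): the maximum achievable M (0 if no maximum exists). *)
Definition Mstar (n : nat) (eps : R) : nat :=
  xget 0%N [set M | achievable n eps M /\ forall M', achievable n eps M' -> (M' <= M)%N].

Definition Lstar (eps : R) : \bar R :=
  limn_einf (fun n => ((ln (Mstar n eps)%:R - n%:R * mutual_info) / Num.sqrt n%:R)%:E).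

End Biometric.

Definition Phi (R : realType) (x : R) : R :=
  fine (\int[@lebesgue_measure R]_(t in `]-oo, x]) (normal_pdf 0 1 t)%:E).

Definition PhiInv (R : realType) (e : R) : R := xget 0 [set t | Phi t = e].

(* Main.v *)
(** The likelihood ratio test between P_{YZ}^n and (P_Y x P_Z)^n governs the
    error probability in both directions: thresholding at M sqrt n loses at most
    1 / sqrt n to the union bound, and conversely every decoder errs at least as
    often as the ratio falls below M / sqrt n, up to 1 / sqrt n.  The logarithm of
    the ratio is a sum of n i.i.d. information densities, so the theorem reduces to
    the central limit theorem for a finitely valued variable.  That is proved by
    Stein's method: if f' is Lipschitz and f' x - x f x >= 1{x <= a} - Phi b, then
    P (W <= a) - Phi b <= E (f' W - W f W) = O(1 / sqrt n) for normalized sums W. *)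
Require Import Defs.
From HB Require Import structures.
From mathcomp Require Import all_boot all_order all_algebra.
From mathcomp Require Import all_classical all_reals all_analysis.
From mathcomp Require Import ring lra.
Set Implicit Arguments. Unset Strict Implicit. Unset Printing Implicit Defensive.
Import Order.TTheory GRing.Theory Num.Theory.
Import numFieldNormedType.Exports.
Local Open Scope classical_set_scope.
Local Open Scope ring_scope.

(** For the indicator of a half-line the derivative of the Stein solution jumps at the threshold, so
    the equation is solved for a ramp descending from [a] to [b] instead. The price is a fixed gap
    between [a] and [b]. It is harmless because the theorem only asks for convergence: each
    direction keeps a slack [d] in the threshold, and the constants may depend on it. A Lipschitz
    [f'] amounts to a bounded derivative of [x * f x]. Outside a compact interval [f] is a multiple
    of the Mills ratio [Phi / phi], at [x] on the left and at [- x] on the right, which is why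
    two-sided Gaussian tail inequalities are needed. In [E (W f W)] exchangeability singles out one
    summand. Its zero mean removes the term of order zero, its variance turns the first-order term
    into [E f'], and a remainder of order [1 / sqrt n] is left. The factor [sqrt n] in the
    likelihood thresholds only has to tend to infinity while its logarithm stays [o(sqrt n)]. *)

Section RealFunctions.
Variable R : realType.
Implicit Types F f : R -> R.

Lemma is_derive_continuous F f : (forall x : R, is_derive x 1 F (f x)) -> continuous F.
Proof.
move=> dF x; apply/differentiable_continuous/derivable1_diffP.
by case: (dF x).
Qed.

Lemma is_derive_MVT F f (a b : R) : (forall x : R, is_derive x 1 F (f x)) ->
  a <= b -> exists2 c, a <= c <= b & F b - F a = f c * (b - a).
Proof.
move=> dF ab.
have cF : {within `[a, b], continuous F}.
  exact/continuous_subspaceT/(is_derive_continuous dF).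
have [c] := MVT_segment ab (fun x _ => dF x) cF.
by rewrite in_itv /=; exists c.
Qed.

Lemma is_derive_ge0_le F f (a b : R) : (forall x : R, is_derive x 1 F (f x)) ->
  a <= b -> (forall x, a <= x <= b -> 0 <= f x) -> F a <= F b.
Proof.
move=> dF ab f0; have [c cab e] := is_derive_MVT dF ab.
by rewrite -subr_ge0 e mulr_ge0 ?f0 ?subr_ge0.
Qed.

Lemma is_derive_lipschitz F f (L : R) : (forall x : R, is_derive x 1 F (f x)) ->
  (forall x, `|f x| <= L) -> forall x y, `|F x - F y| <= L * `|x - y|.
Proof.
move=> dF fL x y; wlog xy : x y / y <= x.
  move=> H; have [/H//|/ltW/H] := leP y x.
  by rewrite distrC (distrC y).
have [c _ ->] := is_derive_MVT dF xy.
by rewrite normrM ler_wpM2r.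
Qed.

Lemma continuous_bounded_itv f (a b : R) : continuous f ->
  exists2 K, 0 <= K & forall x, a <= x <= b -> `|f x| <= K.
Proof.
move=> cf; have [ab|ba] := leP a b; last first.
  by exists 0 => // x /andP[ax /(le_trans ax)]; rewrite leNgt ba.
have cn : {within `[a, b], continuous (fun x => `|f x|)}.
  apply/continuous_subspaceT => x; apply: (@continuous_comp _ _ _ f Num.norm).
    exact: cf.
  exact: norm_continuous.
have [c _ cM] := EVT_max ab cn; exists `|f c| => //.
Qed.

End RealFunctions.

(** * The standard normal distribution function and its tails *)

Section Gaussian.
Variable R : realType.
Local Notation phi := (@normal_pdf R 0 1).
Local Notation Phi := (@Phi R).
Local Notation mu := (@lebesgue_measure R).

Lemma phiE x : phi x = normal_peak 1 * expR (- (x ^+ 2 / 2)).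
Proof.
rewrite normal_pdfE ?oner_neq0//; congr (_ * expR _).
by rewrite subr0 expr1n mulNr.
Qed.

Lemma phi_gt0 x : 0 < phi x.
Proof. by rewrite phiE mulr_gt0 ?expR_gt0// normal_peak_gt0 ?oner_neq0. Qed.

Lemma phi_neq0 x : phi x != 0.
Proof. by rewrite gt_eqF ?phi_gt0. Qed.

Lemma phiN x : phi (- x) = phi x.
Proof. by rewrite !phiE sqrrN. Qed.

Lemma is_derive_phi (x : R) : is_derive x 1 phi (- x * phi x).
Proof.
have -> : phi = fun x => normal_peak 1 * expR (- (x ^+ 2 / 2)).
  by apply/funext => y; exact: phiE.
have := @is_derive1_comp _ expR (fun x : R => - (x ^+ 2 / 2)) x _ _
  (is_derive_expR _) _.
move=> H.
have /H {}H : is_derive x 1 (fun x : R => - (x ^+ 2 / 2)) (- x).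
  have -> : (fun x : R => - (x ^+ 2 / 2)) = (fun x : R => (- 2^-1) *: x ^+ 2).
    by apply/funext => y; rewrite /GRing.scale /=; lra.
  apply: is_derive_eq; rewrite /GRing.scale /=; lra.
have := @is_deriveZ _ _ _ _ (normal_peak 1) x 1 _ H.
move=> {}H; apply: is_derive_eq; rewrite /GRing.scale /=; ring.
Qed.

Lemma integrable_phi (A : set R) : measurable A -> mu.-integrable A (EFin \o phi).
Proof.
move=> mA; apply: (integrableS measurableT) => //; exact: integrable_normal_pdf.
Qed.

(** Domination by [phi] gives integrability down to minus infinity, so the fundamental theorem of
    calculus applies. The cases of interest are [h = 1], which yields [Phi], and the ramp of Stein's
    equation. *)
Lemma antiderivative_mul_phi (h : R -> R) : continuous h ->
  (forall x, 0 <= h x <= 1) ->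
  forall x : R, is_derive x 1
    (fun x => \int[mu]_(t in [set` `]-oo, x]]) (h t * phi t)) (h x * phi x).
Proof.
move=> ch h01 x.
have chp : continuous (fun t => h t * phi t).
  by move=> t; apply: cvgM; [exact: ch|exact: continuous_normal_pdf (oner_neq0 R) t].
have [] := @continuous_FTC1 R (fun t => h t * phi t) -oo%O x (x + 1) _ _ _ _.
- by rewrite ltrDl.
- apply: (@le_integrable _ _ _ mu _ _ _ (EFin \o phi)) => //.
  + apply/measurable_realfun.measurable_EFinP/measurable_funTS.
    exact: measurable_realfun.continuous_measurable_fun.
  + move=> t _ /=; rewrite lee_fin normrM ler_piMl// ger0_norm; by case/andP: (h01 t).
  + exact: integrable_phi.
- by rewrite ltNyr.
- exact: chp.
by move=> d e; apply: DeriveDef; [exact: d|rewrite -derive1E; exact: e].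
Qed.

Lemma PhiE x : Phi x = \int[mu]_(t in [set` `]-oo, x]]) (phi t).
Proof. by []. Qed.

Lemma is_derive_Phi (x : R) : is_derive x 1 Phi (phi x).
Proof.
have := @antiderivative_mul_phi (cst 1) _ _ x; rewrite mul1r.
have -> : Phi = fun x => \int[mu]_(t in [set` `]-oo, x]]) (cst 1 t * phi t).
  by apply/funext => y; rewrite PhiE; apply: eq_Rintegral => t _; rewrite /= mul1r.
apply; first by move=> y; exact: cst_continuous.
by move=> y /=; rewrite ler01 lexx.
Qed.

Lemma continuous_Phi : continuous Phi.
Proof. exact: is_derive_continuous is_derive_Phi. Qed.

(** Under the normal law the identity is a random variable with distribution function [Phi], so
    [Phi] inherits the limits of a cdf. *)
Let idR : measurableTypeR R -> R := idfun.

#[local] HB.instance Definition _ :=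
  @isMeasurableFun.Build _ _ _ _ idR (@measurable_id _ _ setT).

Lemma Phi_cdf x :
  cdf (idR : {RV @normal_prob R 0 1 >-> R}) x = (Phi x)%:E.
Proof.
rewrite /Phi fineK//=.
exact: (fin_num_measure (@normal_prob R 0 1)).
Qed.

Lemma Phi_ge0 x : 0 <= Phi x.
Proof. by rewrite -lee_fin -Phi_cdf cdf_ge0. Qed.

Lemma cvg_Phi_y : Phi x @[x --> +oo] --> (1 : R).
Proof.
apply: (fine_cvg (f := fun x => (Phi x)%:E)).
have := @cvg_cdfy1 _ _ _ _ (idR : {RV @normal_prob R 0 1 >-> R}).
by rewrite (_ : cdf _ = EFin \o Phi)//; apply/funext => x; rewrite Phi_cdf.
Qed.

Lemma cvg_Phi_Ny : Phi x @[x --> -oo] --> (0 : R).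
Proof.
apply: (fine_cvg (f := fun x => (Phi x)%:E)).
have := @cvg_cdfNy0 _ _ _ _ (idR : {RV @normal_prob R 0 1 >-> R}).
by rewrite (_ : cdf _ = EFin \o Phi)//; apply/funext => x; rewrite Phi_cdf.
Qed.

Lemma Phi_increasing : {homo Phi : x y / x < y}.
Proof.
move=> x y xy; have [] := @MVT R Phi phi x y xy.
- by move=> ? _; exact: is_derive_Phi.
- exact/continuous_subspaceT/continuous_Phi.
by move=> c _ e; rewrite -subr_gt0 e mulr_gt0 ?phi_gt0 ?subr_gt0.
Qed.

(** Since [phi] is even, [Phi y + Phi (- y)] has derivative zero; its constant value is its limit at
    infinity. *)
Lemma PhiN x : Phi (- x) = 1 - Phi x.
Proof.
have cstS y : Phi y + Phi (- y) = Phi x + Phi (- x).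
  apply: (@is_derive_0_is_cst R (fun y => Phi y + Phi (- y))) => z.
  have dP := is_derive_Phi z.
  have dN := @is_derive1_comp R Phi -%R z _ _ (is_derive_Phi (- z)) (is_deriveNid z 1).
  by apply: is_derive_eq; rewrite phiN; lra.
suff : Phi x + Phi (- x) = 1 by lra.
have c1 : (Phi y + Phi (- y)) @[y --> +oo] --> (1 + 0 : R).
  apply: (@cvgD _ R^o); first exact: cvg_Phi_y.
  by apply/(@cvgNy_compNP _ _ Phi (nbhs (0:R))); exact: cvg_Phi_Ny.
rewrite -[RHS]addr0; apply: cvg_unique c1; first exact: Rhausdorff.
rewrite (_ : (fun y => Phi y + Phi (- y)) = cst (Phi x + Phi (- x))).
  exact: cvg_cst.
exact/funext.
Qed.

Lemma PhiInvK (e : R) : 0 < e < 1 -> Phi (PhiInv e) = e.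
Proof.
move=> /andP[e0 e1]; rewrite /PhiInv.
suff [t Pt] : exists t, Phi t = e by exact: (@xgetI _ _ [set t | Phi t = e] t).
have [a Pa] : exists a, Phi a < e.
  have [M [_ HM]] := @cvgr_lt _ _ _ _ _ _ cvg_Phi_Ny _ e0.
  by exists (M - 1); apply: HM; rewrite gtrBl.
have [b Pb] : exists b, e < Phi b.
  have [M [_ HM]] := @cvgr_gt _ _ _ _ _ _ cvg_Phi_y _ e1.
  by exists (M + 1); apply: HM; rewrite ltrDl.
have ab : a <= b.
  rewrite leNgt; apply/negP => /Phi_increasing; lra.
have [] := @IVT R Phi a b e ab.
- exact/continuous_subspaceT/continuous_Phi.
- by rewrite ge_min le_max (ltW Pa) (ltW Pb) orbT.
by move=> c _ <-; exists c.
Qed.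

(** Divided by [1 + x ^+ 2], the claim is [0 <= D x]. This [D] has a nonnegative derivative and
    tends to 0 at minus infinity. *)
Lemma Gordon_lower (x : R) : - x * phi x <= (1 + x ^+ 2) * Phi x.
Proof.
pose D y := Phi y + y * (1 + y ^+ 2)^-1 * phi y.
have p2 y : 0 < 1 + y ^+ 2 :> R by rewrite ltr_pwDl ?sqr_ge0.
have n2 y : 1 + y ^+ 2 != 0 :> R by rewrite gt_eqF.
have dD (y : R) : is_derive y 1 D (2 * phi y / (1 + y ^+ 2) ^+ 2).
  have d1 := is_derive_Phi y; have d2 := is_derive_phi y.
  have d3 : is_derive y 1 (fun y : R => 1 + y ^+ 2) (2 * y).
    by apply: is_derive_eq; rewrite /GRing.scale /=; ring.
  have d4 : is_derive y 1 (fun y : R => (1 + y ^+ 2)^-1) (- (1 + y ^+ 2) ^- 2 * (2 * y)).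
    exact: (@is_deriveV _ (fun y : R => 1 + y ^+ 2)).
  rewrite /D; apply: is_derive_eq; rewrite /GRing.scale /=.
  by field.
suff : 0 <= D x.
  rewrite /D -(pmulr_rge0 _ (p2 x)) mulrDr => H; rewrite -subr_ge0; apply: le_trans H _.
  by rewrite le_eqVlt; apply/orP; left; apply/eqP; field.
apply/ler_addgt0Pr => /= e e0; rewrite -lerBlDr sub0r.
pose p : R := normal_peak 1; have p0 : 0 < p by rewrite normal_peak_gt0 ?oner_neq0.
(* The term in [x] puts [y] to the left of [x]; the term [p / e], with [p] the maximum of [phi],
   forces [- e <= D y]. *)
pose y : R := - (`|x| + 1 + p / e).
have pe : 0 < p / e by rewrite divr_gt0.
have ny : 0 < - y by rewrite /y opprK addr_gt0// ltr_wpDl.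
apply: (@le_trans _ _ (D y)); last first.
  apply: is_derive_ge0_le dD _ _.
    have := ler_norm (- x); rewrite normrN /y; lra.
  by move=> z _; rewrite divr_ge0 ?sqr_ge0// mulr_ge0// ltW// phi_gt0.
apply: (@le_trans _ _ (0 + y * (1 + y ^+ 2)^-1 * phi y)); last by rewrite lerD2r Phi_ge0.
rewrite add0r -[leRHS]opprK lerN2 -!mulNr.
apply: (@le_trans _ _ (- y / (1 + y ^+ 2) * p)).
  rewrite ler_pM2l ?divr_gt0//; exact/normal_pdf_ub/oner_neq0.
rewrite mulrAC ler_pdivrMr//.
have : p <= e * - y.
  rewrite /y opprK mulrDr mulrCA mulfV ?gt_eqF// mulr1.
  by rewrite lerDr mulr_ge0 ?(ltW e0)// addr_ge0.
by move=> H; nra.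
Qed.

(** Again a function that increases from its limit 0 at minus infinity; [U] is singular at 0, so the
    mean value theorem is applied on a segment of the negative half-line. *)
Lemma Gordon_upper (x : R) : x < 0 -> - x * Phi x <= phi x.
Proof.
move=> x0; pose U y := - (phi y / y) - Phi y.
have dU (y : R) : y < 0 -> is_derive y 1 U (phi y / y ^+ 2).
  move=> y0; have d1 := is_derive_Phi y; have d2 := is_derive_phi y.
  have ny0 : y != 0 by rewrite lt_eqF.
  have d4 : is_derive y 1 (fun y : R => y^-1) (- y ^- 2 * 1).
    exact: (@is_deriveV _ id).
  rewrite /U; apply: is_derive_eq; rewrite /GRing.scale /=.
  by field.
suff : 0 <= U x.
  rewrite /U subr_ge0 => H; rewrite -ler_pdivlMl ?oppr_gt0//.
  by rewrite invrN mulNr mulrC.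
apply/ler_addgt0Pr => /= e e0; rewrite -lerBlDr sub0r.
have [y yx Py] : exists2 y, y < x & Phi y < e.
  have [M [_ HM]] := @cvgr_lt _ _ _ _ _ _ cvg_Phi_Ny _ e0.
  have [xM|Mx] := ltP x M; [exists (x - 1)|exists (M - 1)]; rewrite ?gtrBl//.
  - by apply: HM; rewrite ltrBlDr ltr_wpDr.
  - by rewrite ltrBlDr ltr_pwDr.
  - by apply: HM; rewrite gtrBl.
apply: (@le_trans _ _ (U y)).
  have : phi y / y <= 0.
    by rewrite mulr_ge0_le0 ?(ltW (phi_gt0 _))// invr_le0 (ltW (lt_trans yx x0)).
  rewrite /U; lra.
have [] := @MVT_segment R U (fun y => phi y / y ^+ 2) y x (ltW yx).
- move=> z; rewrite in_itv /= => /andP[_ zx]; apply: dU; exact: lt_trans zx x0.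
- apply: derivable_within_continuous => z; rewrite in_itv /= => /andP[_ zx].
  by case: (dU z (le_lt_trans zx x0)).
move=> c _ E; rewrite -subr_ge0 E mulr_ge0 ?subr_ge0 ?(ltW yx)//.
by rewrite divr_ge0 ?sqr_ge0 ?(ltW (phi_gt0 _)).
Qed.

End Gaussian.

(** * Stein's equation for a ramp *)

Section Stein.
Variable R : realType.
Local Notation phi := (@normal_pdf R 0 1).
Local Notation Phi := (@Phi R).
Local Notation mu := (@lebesgue_measure R).

Lemma lipschitz_continuous (f : R -> R) (L : R) :
  (forall x y, `|f x - f y| <= L * `|x - y|) -> continuous f.
Proof.
move=> fL x; apply/cvgrPdist_lt => /= e e0.
have L0 : 0 < `|L| + 1 by rewrite ltr_wpDl.
have eL : 0 < e / (`|L| + 1) by rewrite divr_gt0.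
apply: filterS (nbhsx_ballx x _ eL) => y; rewrite /ball /= => xy.
apply: le_lt_trans (fL x y) _.
apply: (@le_lt_trans _ _ ((`|L| + 1) * `|x - y|)).
  by rewrite ler_wpM2r// (le_trans (ler_norm L))// lerDl.
by rewrite mulrC -ltr_pdivlMr.
Qed.

Definition ramp (a b x : R) : R := Num.min 1 (Num.max 0 ((b - x) / (b - a))).

Lemma ramp01 a b x : 0 <= ramp a b x <= 1.
Proof. by rewrite /ramp le_min ler01 le_max lexx ge_min lexx. Qed.

Lemma ramp_left a b x : a < b -> x <= a -> ramp a b x = 1.
Proof.
move=> ab xa; rewrite /ramp min_l// le_max ler_pdivlMr ?subr_gt0// mul1r.
by rewrite lerD2l lerN2 xa orbT.
Qed.

Lemma ramp_right a b x : a < b -> b <= x -> ramp a b x = 0.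
Proof.
move=> ab bx; rewrite /ramp (max_l (y := _ / _)) ?min_r//.
by rewrite pmulr_lle0 ?invr_gt0 ?subr_gt0// subr_le0.
Qed.

Lemma ramp_lipschitz a b x y : a < b ->
  `|ramp a b x - ramp a b y| <= (b - a)^-1 * `|x - y|.
Proof.
move=> ab; wlog xy : x y / y <= x.
  move=> H; have [/H//|/ltW/H] := leP y x.
  by rewrite distrC (distrC y).
have ba : 0 < (b - a)^-1 by rewrite invr_gt0 subr_gt0.
have : (b - y) / (b - a) = (b - x) / (b - a) + (b - a)^-1 * (x - y) by ring.
rewrite (ger0_norm (x := x - y)) ?subr_ge0// /ramp.
set u := _ / _; set v := _ / _; set w := _ * _ => e.
have w0 : 0 <= w by rewrite mulr_ge0 ?(ltW ba)// subr_ge0.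
rewrite ler_norml; apply/andP.
by case: (leP 0 u); case: (leP 0 v); rewrite ?minElt;
  (repeat case: ifPn); rewrite -?leNgt; move=> *; lra.
Qed.

(** The bounded expression is the derivative of [x * (Phi x / phi x)]; the two tail inequalities
    bound it from below and from above. *)
Lemma mills_bounds (x : R) : x <= -1 ->
  0 <= (1 + x ^+ 2) * (Phi x / phi x) + x <= 1.
Proof.
move=> x1; have x0 : x < 0 by lra.
have p0 := @phi_gt0 R x.
have lo := Gordon_lower x; have up := Gordon_upper x0.
have A0 : 0 <= Phi x / phi x by rewrite divr_ge0 ?Phi_ge0 ?ltW.
have {}lo : - x <= (1 + x ^+ 2) * (Phi x / phi x) by rewrite mulrA ler_pdivlMr.
have {}up : - x * (Phi x / phi x) <= 1 by rewrite mulrA ler_pdivrMr// mul1r.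
by move: A0 lo up; set A := Phi x / phi x => A0 lo up; nra.
Qed.

(* The function [f] below solves Stein's equation [f' x - x f x = h x - E h(N)]
   for the ramp [h] descending from 1 at [a] to 0 at [b], [N] standard normal. *)
Lemma stein_function (a b : R) : a < b ->
  exists f f' : R -> R, exists L : R,
  [/\ forall x : R, is_derive x 1 f (f' x),
      forall x y, `|f' x - f' y| <= L * `|x - y| &
      forall x, (x <= a)%R%:R - Phi b <= f' x - x * f x].
Proof.
move=> ab; pose h := ramp a b.
have ch : continuous h by apply: lipschitz_continuous => x y; exact: ramp_lipschitz.
pose H (x : R) : R := \int[mu]_(t in [set` `]-oo, x]]) (h t * phi t).
have dH : forall x : R, is_derive x 1 H (h x * phi x).
  by apply: antiderivative_mul_phi => // x; exact: ramp01.
have Ha x : x <= a -> H x = Phi x.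
  move=> xa; rewrite PhiE; apply: eq_Rintegral => t.
  by rewrite inE /= in_itv /= => tx; rewrite /h ramp_left ?mul1r// (le_trans tx).
(* This is the mean of the ramp under the normal law, since the ramp vanishes beyond [b]. *)
pose c := H b.
have Hb x : b <= x -> H x = c.
  move=> bx; have [y /andP[yb _]] := is_derive_MVT dH bx.
  by rewrite /h ramp_right// !mul0r => /eqP; rewrite subr_eq0 => /eqP.
have c_le : c <= Phi b.
  have dPH (x : R) : is_derive x 1 (fun x => Phi x - H x) ((1 - h x) * phi x).
    by have := is_derive_Phi x => ?; apply: is_derive_eq; ring.
  have := @is_derive_ge0_le _ _ _ a b dPH (ltW ab).
  rewrite Ha// subrr subr_ge0; apply => x _.
  by have /andP[_ h1] := ramp01 a b x; rewrite mulr_ge0 ?subr_ge0// ltW// phi_gt0.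
have c_ge0 : 0 <= c.
  apply: (@le_trans _ _ (H a)); first by rewrite Ha// Phi_ge0.
  apply: is_derive_ge0_le dH (ltW ab) _ => x _.
  by have /andP[h0 _] := ramp01 a b x; rewrite mulr_ge0// ltW// phi_gt0.
have c_le1 : c <= 1.
  by apply: (le_trans c_le); rewrite -subr_ge0 -PhiN Phi_ge0.
(* The integrating factor of [f' x - x * f x] is [phi], so [f * phi] is the integral of
   [(h - c) * phi] from minus infinity. *)
pose f x := (H x - c * Phi x) * (phi x)^-1.
pose f' x := x * f x + h x - c.
have df (x : R) : is_derive x 1 f (f' x).
  have d1 := is_derive_Phi x; have d2 := is_derive_phi x.
  have d3 : is_derive x 1 (fun y : R => (phi y)^-1) (- phi x ^- 2 * (- x * phi x)).
    exact: (@is_deriveV _ phi _ _ _ (phi_neq0 x)).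
  have d4 : is_derive x 1 (fun y : R => H y - c * Phi y) (h x * phi x - c * phi x).
    have := is_deriveB (dH x) (is_deriveZ c d1); exact.
  rewrite /f; apply: is_derive_eq; rewrite /f' /f /GRing.scale /=.
  by have := @phi_neq0 R x => ?; field.
exists f, f'.
have cf : continuous f := is_derive_continuous df.
pose g x := f x + x * f' x.
have dq (x : R) : is_derive x 1 (fun x => x * f x) (g x).
  have := df x => ?; apply: is_derive_eq; rewrite /g /GRing.scale /=; ring.
have cg : continuous g.
  have cf' : continuous f'.
    move=> x; apply: (@cvgB _ R^o); last exact: cvg_cst.
    by apply: (@cvgD _ R^o); [apply: cvgM; [exact: cvg_id|exact: cf]|exact: ch].
  move=> x; apply: (@cvgD _ R^o); first exact: cf.
  by apply: cvgM; [exact: cvg_id|exact: cf'].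
(* Beyond [K] in modulus the ramp is constant and [mills_bounds] applies: [f] is
   [(1 - c) * (Phi x / phi x)] on the left, and [c] times the same ratio at [- x] on the right. In
   between, continuity bounds [g]. *)
pose K := `|a| + `|b| + 1.
have [G G0 gG] := continuous_bounded_itv (- K) K cg.
have a1 := ler_norm (- a); have b1 := ler_norm b; rewrite normrN in a1.
have a2 := normr_ge0 a; have b2 := normr_ge0 b.
have gB x : `|g x| <= G + 1.
  have [Kx|xK] := ltP x (- K).
    rewrite ler_wpDl// ler_norml.
    have x1 : x <= -1 by rewrite /K in Kx; lra.
    have xa : x <= a by rewrite /K in Kx; lra.
    have := mills_bounds x1.
    have -> : g x = (1 - c) * ((1 + x ^+ 2) * (Phi x / phi x) + x).
      by rewrite /g /f' /f /h ramp_left// Ha//; ring.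
    by move=> /andP[]; set A := (_ + x) => A0 A1; apply/andP; split; nra.
  have [Kx|xK'] := ltP K x.
    rewrite ler_wpDl// ler_norml.
    have x1 : - x <= -1 by rewrite /K in Kx; lra.
    have xb : b <= x by rewrite /K in Kx; lra.
    have := mills_bounds x1.
    have -> : g x = c * ((1 + (- x) ^+ 2) * (Phi (- x) / phi (- x)) - x).
      by rewrite /g /f' /f /h ramp_right// Hb// PhiN phiN; ring.
    by move=> /andP[]; set A := (_ - x) => A0 A1; apply/andP; split; nra.
  by rewrite (le_trans (gG x _)) ?xK ?xK'// lerDl.
exists (G + 1 + (b - a)^-1); split=> //.
- move=> x y.
  have -> : f' x - f' y = (x * f x - y * f y) + (h x - h y) by rewrite /f'; ring.
  apply: (le_trans (ler_normD _ _)); rewrite mulrDl lerD ?ramp_lipschitz//.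
  exact: is_derive_lipschitz dq gB x y.
- move=> x; have -> : f' x - x * f x = h x - c by rewrite /f'; ring.
  apply: lerB => //; have [xa|_] := leP x a; first by rewrite /h ramp_left.
  by case/andP: (ramp01 a b x).
Qed.

End Stein.

(** * Expectations over i.i.d. sums and Stein's estimate *)

Lemma sum_ffun_ordS (R : realType) (T : finType) n (F : {ffun 'I_n.+1 -> T} -> R) :
  \sum_t F t = \sum_a \sum_(u : {ffun 'I_n -> T})
    F [ffun i => if unlift ord0 i is Some j then u j else a].
Proof.
rewrite pair_big /=.
pose h (p : T * {ffun 'I_n -> T}) : {ffun 'I_n.+1 -> T} :=
  [ffun i => if unlift ord0 i is Some j then p.2 j else p.1].
rewrite (reindex h) //=; exists (fun t => (t ord0, [ffun j => t (lift ord0 j)])).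
  move=> [a u] _ /=; congr pair; first by rewrite ffunE unlift_none.
  by apply/ffunP => j; rewrite !ffunE liftK.
move=> t _; apply/ffunP => i; rewrite ffunE.
by case: unliftP => [j ->|->] //=; rewrite ffunE.
Qed.

Lemma taylor1_lipschitz (R : realType) (f f' : R -> R) (L : R) :
  (forall x : R, is_derive x 1 f (f' x)) ->
  (forall x y, `|f' x - f' y| <= L * `|x - y|) ->
  forall u d, `|f (u + d) - f u - d * f' u| <= L * d ^+ 2.
Proof.
move=> df fL u d.
have [c E] : exists2 c, `|c - u| <= `|d| & f (u + d) - f u = f' c * d.
  have [d0|d0] := leP 0 d.
    have ud : u <= u + d by rewrite lerDl.
    have [c cud E] := is_derive_MVT df ud.
    exists c; last by rewrite E; congr (_ * _); ring.
    by rewrite (ger0_norm d0) ger0_norm; lra.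
  have du : u + d <= u by rewrite gerDl ltW.
  have [c cud E] := is_derive_MVT df du.
  exists c; last by rewrite -opprB E; ring.
  by rewrite (ltr0_norm d0) ler0_norm; lra.
move=> ->; rewrite (_ : _ - _ = (f' c - f' u) * d); last ring.
have L0 : 0 <= L by have := fL 1 0; rewrite subr0 normr1 mulr1; exact: le_trans.
rewrite normrM -(real_normK (num_real d)) expr2 mulrA ler_wpM2r//.
by apply: (le_trans (fL _ _)); rewrite ler_wpM2l.
Qed.

Section IteratedExpectation.
Variables (R : realType) (T : finType) (Q : T -> R).
Hypothesis dQ : is_dist Q.

Let Q0 t : 0 <= Q t. Proof. by case: dQ. Qed.
Let Q1 : \sum_t Q t = 1. Proof. by case: dQ. Qed.

(* Expectation of [g (x + xi t_1 + ... + xi t_n)] for [t_i] i.i.d. of law [Q]. *)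
Fixpoint iterE (xi : T -> R) (n : nat) (g : R -> R) (x : R) : R :=
  if n is n'.+1 then \sum_t Q t * iterE xi n' g (x + xi t) else g x.

Variable xi : T -> R.
Local Notation E := (iterE xi).

Lemma iterES n g x : E n.+1 g x = \sum_t Q t * E n g (x + xi t).
Proof. by []. Qed.

Lemma iterE_sum n (g : R -> R) x :
  \sum_(t : {ffun 'I_n -> T}) (\prod_i Q (t i)) * g (x + \sum_i xi (t i)) = E n g x.
Proof.
elim: n x => [|n IH] x /=.
  rewrite (big_pred1 (@ffun0 'I_0 (fun=> T) (card_ord 0))).
    by rewrite !big_ord0 mul1r addr0.
  by move=> t /=; apply/esym/eqP/ffunP; case.
rewrite sum_ffun_ordS; apply: eq_bigr => a _; rewrite -IH mulr_sumr.
apply: eq_bigr => u _; rewrite !big_ord_recl !ffunE unlift_none mulrA addrA.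
congr (_ * _ * g (_ + _)); apply: eq_bigr => i _; by rewrite ffunE liftK.
Qed.

Lemma eq_iterE n (g h : R -> R) x : g =1 h -> E n g x = E n h x.
Proof. by move=> gh; elim: n x => //= n IH x; apply: eq_bigr => t _; rewrite IH. Qed.

Lemma le_iterE n (g h : R -> R) x : (forall y, g y <= h y) -> E n g x <= E n h x.
Proof.
by move=> gh; elim: n x => //= n IH x; apply: ler_sum => t _; rewrite ler_wpM2l.
Qed.

Lemma iterED n (g h : R -> R) x : E n (fun y => g y + h y) x = E n g x + E n h x.
Proof.
elim: n x => //= n IH x; rewrite -big_split /=.
by apply: eq_bigr => t _; rewrite IH mulrDr.
Qed.

Lemma iterEZ n k (g : R -> R) x : E n (fun y => k * g y) x = k * E n g x.
Proof.
elim: n x => //= n IH x; rewrite mulr_sumr.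
by apply: eq_bigr => t _; rewrite IH mulrCA.
Qed.

Lemma iterE_cst n (c x : R) : E n (fun=> c) x = c.
Proof.
by elim: n x => //= n IH x; under eq_bigr do rewrite IH; rewrite -mulr_suml Q1 mul1r.
Qed.

Lemma iterE_shift n (g : R -> R) s x : E n (fun y => g (y + s)) x = E n g (x + s).
Proof. by elim: n x => //= n IH x; apply: eq_bigr => t _; rewrite IH addrAC. Qed.

Lemma iterEB n (g h : R -> R) x : E n (fun y => g y - h y) x = E n g x - E n h x.
Proof.
rewrite iterED -mulN1r -iterEZ; congr (_ + _).
by apply: eq_iterE => y; rewrite mulN1r.
Qed.

Lemma iterE_norm_le n (g : R -> R) c x : (forall y, `|g y| <= c) -> `|E n g x| <= c.
Proof.
move=> gc; rewrite ler_norml; apply/andP; split.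
  rewrite -(iterE_cst n (- c) x); apply: le_iterE => y.
  by move: (gc y); rewrite ler_norml => /andP[].
rewrite -(iterE_cst n c x); apply: le_iterE => y.
by move: (gc y); rewrite ler_norml => /andP[].
Qed.

(* By exchangeability only one summand is singled out. *)
Lemma iterE_size_bias n (f : R -> R) x :
  E n.+1 (fun y => (y - x) * f y) x = n.+1%:R * \sum_t Q t * (xi t * E n f (x + xi t)).
Proof.
elim: n x => [|n IH] x.
  by rewrite mul1r /=; apply: eq_bigr => t _; congr (_ * (_ * _)); ring.
transitivity (\sum_t Q t * (xi t * E n.+1 f (x + xi t) +
    E n.+1 (fun y => (y - (x + xi t)) * f y) (x + xi t))).
  rewrite [LHS]iterES; apply: eq_bigr => t _; congr (_ * _).
  rewrite -iterEZ -iterED; apply: eq_iterE => y; ring.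
under eq_bigr do rewrite IH mulrDr.
rewrite big_split /= -[in RHS]natr1 mulrDl mul1r addrC; congr (_ + _).
under eq_bigr do rewrite mulrCA mulr_sumr.
rewrite -mulr_sumr; congr (_ * _); rewrite exchange_big /=.
apply: eq_bigr => t _; rewrite !mulr_sumr; apply: eq_bigr => u _.
by rewrite addrAC; ring.
Qed.

Variable sigma : R.
Hypothesis sigma_gt0 : 0 < sigma.
Hypothesis mean0 : \sum_t Q t * xi t = 0.
Hypothesis var_xi : \sum_t Q t * xi t ^+ 2 = sigma ^+ 2.

(** Both terms of Stein's expression are compared with [D], the mean of [F'] over one summand fewer.
    The first absolute moment [m1] controls the added summand in [E F'], the third one [m3] the
    Taylor remainder in [E (W f W)]. *)
Lemma clt_upper_iterE a b : a < b -> exists C, forall n,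
  E n.+1 (fun y => (y <= a * (sigma * Num.sqrt n.+1%:R))%R%:R) 0
    <= Phi b + C / Num.sqrt n.+1%:R.
Proof.
move=> ab; have [f [f' [L [df fL fab]]]] := stein_function ab.
have L0 : 0 <= L by have := fL 1 0; rewrite subr0 normr1 mulr1; exact: le_trans.
pose m1 := \sum_t Q t * `|xi t|; pose m3 := \sum_t Q t * `|xi t| ^+ 3.
exists (L * (m1 + m3 / sigma ^+ 2) / sigma) => n.
set N : R := n.+1%:R; pose s := sigma * Num.sqrt N.
have N0 : 0 < N by rewrite ltr0n.
have s0 : 0 < s by rewrite mulr_gt0// sqrtr_gt0.
have ss : s ^+ 2 = sigma ^+ 2 * N by rewrite exprMn sqr_sqrtr// ltW.
pose F y := f (y / s); pose F' y := f' (y / s).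
pose D := E n F' 0.
have FF' y d : `|F (y + d) - F y - d / s * F' y| <= L * (d / s) ^+ 2.
  by rewrite /F mulrDl; exact: taylor1_lipschitz df fL _ _.
have step1 : E n.+1 (fun y => (y <= a * s)%R%:R) 0 - Phi b
    <= E n.+1 F' 0 - s^-1 * E n.+1 (fun y => (y - 0) * F y) 0.
  rewrite -(iterE_cst n.+1 (Phi b) 0) -iterEB -iterEZ -iterEB.
  apply: le_iterE => y; have := fab (y / s).
  by rewrite ler_pdivrMr// /F' /F subr0 mulrA (mulrC y).
have step2 : E n.+1 F' 0 <= D + L * m1 / s.
  have -> : D + L * m1 / s = \sum_t Q t * (D + L * `|xi t| / s).
    under eq_bigr do rewrite mulrDr.
    rewrite big_split /= -mulr_suml Q1 mul1r /m1 mulr_sumr mulr_suml.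
    by congr (_ + _); apply: eq_bigr => t _; ring.
  rewrite iterES; apply: ler_sum => t _; rewrite ler_wpM2l// -lerBlDl.
  rewrite -iterE_shift -iterEB.
  apply: (le_trans (ler_norm _)); apply: iterE_norm_le => y.
  apply: (le_trans (fL _ _)); rewrite -mulrBl addrAC subrr add0r normrM mulrA.
  by rewrite (gtr0_norm (x := s^-1)) ?invr_gt0.
have step3 t : `|E n F (xi t) - E n F 0 - xi t / s * D| <= L * (xi t / s) ^+ 2.
  rewrite -[X in E n F X - _]add0r -iterE_shift -iterEB -iterEZ -iterEB.
  exact: iterE_norm_le.
have step4 : D - L * m3 / (sigma ^+ 2 * s) <= s^-1 * E n.+1 (fun y => (y - 0) * F y) 0.
  rewrite iterE_size_bias -/N.
  (* As [xi] has mean zero, the constant [E n F 0] can be subtracted, which leaves an increment for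
     [step3] to expand. *)
  have -> : \sum_t Q t * (xi t * E n F (0 + xi t)) =
      \sum_t Q t * (xi t * (E n F (xi t) - E n F 0)).
    under [RHS]eq_bigr do rewrite 2!mulrBr.
    rewrite sumrB; under [X in _ = _ - X]eq_bigr do rewrite mulrA.
    rewrite -mulr_suml mean0 mul0r subr0.
    by under eq_bigr do rewrite add0r.
  have lb : sigma ^+ 2 / s * D - L * m3 / s ^+ 2 <=
      \sum_t Q t * (xi t * (E n F (xi t) - E n F 0)).
    have -> : sigma ^+ 2 / s * D - L * m3 / s ^+ 2 = \sum_t
        Q t * (xi t * (xi t / s * D) - L * (`|xi t| ^+ 3 / s ^+ 2)).
      under eq_bigr do rewrite mulrBr.
      rewrite sumrB -var_xi /m3 mulr_sumr !mulr_suml.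
      by congr (_ - _); apply: eq_bigr => t _; ring.
    apply: ler_sum => t _; rewrite ler_wpM2l//.
    have := step3 t; set u := E n F (xi t) - _ => st3.
        have : - (`|xi t| * `|u - xi t / s * D|) <= xi t * (u - xi t / s * D).
      by rewrite -normrM lerNl; rewrite -normrN ler_norm.
    have : `|xi t| * `|u - xi t / s * D| <= `|xi t| * (L * (xi t / s) ^+ 2).
      by rewrite ler_wpM2l.
    have -> : `|xi t| * (L * (xi t / s) ^+ 2) = L * (`|xi t| ^+ 3 / s ^+ 2).
      rewrite exprMn -(real_normK (num_real (xi t))) exprVn; ring.
    lra.
  have : s^-1 * (N * (sigma ^+ 2 / s * D - L * m3 / s ^+ 2)) <=
      s^-1 * (N * (\sum_t Q t * (xi t * (E n F (xi t) - E n F 0)))).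
    by rewrite ler_wpM2l ?invr_ge0 ?(ltW s0)// ler_wpM2l// ltW.
  apply: le_trans; rewrite le_eqVlt; apply/orP; left; apply/eqP.
  (* With this normalization [D] gets coefficient exactly 1 and cancels against [step2]. *)
  have NE : N = s ^+ 2 / sigma ^+ 2 by rewrite ss mulrC mulKf// expf_neq0// gt_eqF.
  by rewrite NE; field; rewrite !gt_eqF.
rewrite -/s -lerBlDl.
have -> : L * (m1 + m3 / sigma ^+ 2) / sigma / Num.sqrt N =
    L * m1 / s + L * m3 / (sigma ^+ 2 * s).
  by rewrite /s; field; rewrite !gt_eqF// sqrtr_gt0.
by move: step1 step2 step4; lra.
Qed.

End IteratedExpectation.

(** * Two one-sided forms of the central limit theorem *)

Section CentralLimitTheorem.
Variables (R : realType) (T : finType) (Q xi : T -> R) (sigma : R).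

Definition sum_cdf n (c : R) : R := \sum_(t : {ffun 'I_n -> T})
  (\prod_i Q (t i)) * (\sum_i xi (t i) <= c)%R%:R.

Hypothesis dQ : is_dist Q.
Hypothesis sigma_gt0 : 0 < sigma.
Hypothesis mean0 : \sum_t Q t * xi t = 0.
Hypothesis var_xi : \sum_t Q t * xi t ^+ 2 = sigma ^+ 2.

Lemma sum_cdfE n c : sum_cdf n c = iterE Q xi n (fun y => (y <= c)%R%:R) 0.
Proof. rewrite /sum_cdf -iterE_sum; apply: eq_bigr => t _; by rewrite add0r. Qed.

Lemma le_sum_cdf n c d : c <= d -> sum_cdf n c <= sum_cdf n d.
Proof.
move=> cd; rewrite !sum_cdfE; apply: le_iterE => // y.
by rewrite ler_nat; case: (leP y c) => // yc; rewrite (le_trans yc cd).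
Qed.

Lemma clt_upper a b : a < b -> exists C, forall n, (0 < n)%N ->
  sum_cdf n (a * (sigma * Num.sqrt n%:R)) <= Phi b + C / Num.sqrt n%:R.
Proof.
move=> /(clt_upper_iterE dQ sigma_gt0 mean0 var_xi)[C H].
by exists C => -[//|n] _; rewrite sum_cdfE.
Qed.

Lemma iterE_opp n (g : R -> R) x :
  iterE Q (fun t => - xi t) n g x = iterE Q xi n (g \o -%R) (- x).
Proof.
by elim: n x => /= [|n IH] x; [rewrite opprK|apply: eq_bigr => t _; rewrite IH opprD opprK].
Qed.

(** The upper bound is applied to [- xi]: the events that the sum is at most [s] and at least [s]
    cover everything, so their probabilities add up to at least 1. *)
Lemma clt_lower a b : b < a -> exists C, forall n, (0 < n)%N ->
  Phi b - C / Num.sqrt n%:R <= sum_cdf n (a * (sigma * Num.sqrt n%:R)).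
Proof.
rewrite -ltrN2 => ab.
have mean0' : \sum_t Q t * - xi t = 0.
  by under eq_bigr do rewrite mulrN; rewrite sumrN mean0 oppr0.
have var' : \sum_t Q t * (- xi t) ^+ 2 = sigma ^+ 2.
  by rewrite -var_xi; apply: eq_bigr => t _; rewrite sqrrN.
have [C H] := clt_upper_iterE dQ sigma_gt0 mean0' var' ab.
exists C => -[//|n] _; have := H n; rewrite iterE_opp oppr0 PhiN sum_cdfE.
set s := a * _; have -> : - a * (sigma * Num.sqrt n.+1%:R) = - s by rewrite mulNr.
have : 1 <= iterE Q xi n.+1 ((fun y => (y <= - s)%R%:R) \o -%R) 0
    + iterE Q xi n.+1 (fun y => (y <= s)%R%:R) 0.
  rewrite -iterED -[leLHS](iterE_cst dQ xi n.+1 1 0); apply: le_iterE => // y /=.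
  by rewrite lerN2; case: (leP y s) => [ys|/ltW ->]; rewrite ?lerDr ?lerDl ler0n.
lra.
Qed.

End CentralLimitTheorem.

(** * Error probability and the likelihood ratio test *)

Section Coding.
Variables (R : realType) (X Y Z : finType).
Variables (PX : X -> R) (PYgX : X -> Y -> R) (PZgX : X -> Z -> R).
Hypotheses (dX : is_dist PX) (dY : is_channel PYgX) (dZ : is_channel PZgX).

Local Notation pYZ := (PYZ PX PYgX PZgX).
Local Notation pY := (PY PX PYgX PZgX).
Local Notation pZ := (PZ PX PYgX PZgX).

Lemma PYZ_ge0 y z : 0 <= pYZ y z.
Proof.
apply: sumr_ge0 => x _; rewrite !mulr_ge0//; first by case: dX.
  by case: (dY x).
by case: (dZ x).
Qed.

Lemma PY_ge0 y : 0 <= pY y.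
Proof. by apply: sumr_ge0 => z _; exact: PYZ_ge0. Qed.

Lemma PZ_ge0 z : 0 <= pZ z.
Proof. by apply: sumr_ge0 => y _; exact: PYZ_ge0. Qed.

Lemma PYE y : pY y = \sum_x PX x * PYgX x y.
Proof.
rewrite /PY /PYZ exchange_big /=; apply: eq_bigr => x _.
by rewrite -mulr_sumr; case: (dZ x) => _ ->; rewrite mulr1.
Qed.

Lemma sum_PY : \sum_y pY y = 1.
Proof.
under eq_bigr do rewrite PYE; rewrite exchange_big /=.
under eq_bigr => x _ do rewrite -mulr_sumr (proj2 (dY x)) mulr1.
by case: dX.
Qed.

Lemma sum_PZ : \sum_z pZ z = 1.
Proof. by rewrite -sum_PY /PZ /PY exchange_big. Qed.

Lemma PYZ_gt0 y z : 0 < pYZ y z -> 0 < pY y /\ 0 < pZ z.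
Proof.
move=> p; split; apply: (lt_le_trans p).
  by rewrite /PY (bigD1 z)//= lerDl sumr_ge0// => ? _; exact: PYZ_ge0.
by rewrite /PZ (bigD1 y)//= lerDl sumr_ge0// => ? _; exact: PYZ_ge0.
Qed.

Definition PYn n (u : {ffun 'I_n -> Y}) : R := \prod_i pY (u i).
Definition PZn n (z : {ffun 'I_n -> Z}) : R := \prod_i pZ (z i).
Definition PYZn n (u : {ffun 'I_n -> Y}) (z : {ffun 'I_n -> Z}) : R :=
  \prod_i pYZ (u i) (z i).

Lemma PYn_ge0 n (u : {ffun 'I_n -> Y}) : 0 <= PYn u.
Proof. by apply: prodr_ge0 => i _; exact: PY_ge0. Qed.

Lemma PZn_ge0 n (u : {ffun 'I_n -> Z}) : 0 <= PZn u.
Proof. by apply: prodr_ge0 => i _; exact: PZ_ge0. Qed.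

Lemma PYZn_ge0 n (u : {ffun 'I_n -> Y}) (z : {ffun 'I_n -> Z}) : 0 <= PYZn u z.
Proof. by apply: prodr_ge0 => i _; exact: PYZ_ge0. Qed.

Lemma sum_PYn n : \sum_(u : {ffun 'I_n -> Y}) PYn u = 1.
Proof.
by rewrite -(bigA_distr_bigA (fun _ => pY)) big1// => i _; exact: sum_PY.
Qed.

Lemma sum_PZn n : \sum_(u : {ffun 'I_n -> Z}) PZn u = 1.
Proof.
by rewrite -(bigA_distr_bigA (fun _ => pZ)) big1// => i _; exact: sum_PZ.
Qed.

Lemma sum_PYZn_l n (z : {ffun 'I_n -> Z}) : \sum_u PYZn u z = PZn z.
Proof. by rewrite -(bigA_distr_bigA (fun i y => pYZ y (z i))). Qed.

Lemma sum_PYZn n : \sum_(z : {ffun 'I_n -> Z}) \sum_(u : {ffun 'I_n -> Y}) PYZn u z = 1.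
Proof. by under eq_bigr do rewrite sum_PYZn_l; exact: sum_PZn. Qed.

(* Joint law of the database [ys] and the observation [z] given [W = w]. *)
Definition joint n M (w : 'I_M) (ys : {ffun 'I_M -> {ffun 'I_n -> Y}})
    (z : {ffun 'I_n -> Z}) : R :=
  \prod_m (if m == w then PYZn (ys m) z else PYn (ys m)).

Lemma joint_ge0 n M (w : 'I_M) ys (z : {ffun 'I_n -> Z}) : 0 <= joint w ys z.
Proof.
by apply: prodr_ge0 => m _; case: ifP => _; [exact: PYZn_ge0|exact: PYn_ge0].
Qed.

(** The decoder never sees [xs], and [z] depends only on the entry [xs w]; hence summing out [xs]
    factors over items and letters. *)
Lemma err_probE n M (g : {ffun 'I_M -> {ffun 'I_n -> Y}} -> {ffun 'I_n -> Z} -> 'I_M) :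
  err_prob PX PYgX PZgX g = M%:R^-1 *
    \sum_w \sum_z \sum_ys joint w ys z * (g ys z != w)%:R.
Proof.
rewrite /err_prob exchange_big /=.
under eq_bigr do rewrite exchange_big /=.
under eq_bigr do under eq_bigr do rewrite exchange_big /=.
rewrite exchange_big /= mulr_sumr; apply: eq_bigr => w _.
rewrite exchange_big /= mulr_sumr; apply: eq_bigr => z _.
rewrite mulr_sumr; apply: eq_bigr => ys _.
rewrite mulrA -mulr_suml; congr (_ * _); last by case: (_ != _).
under eq_bigr do rewrite -mulrA; rewrite -mulr_sumr; congr (_ * _).
have -> : joint w ys z = \prod_m \prod_i \sum_x
    (PX x * PYgX x (ys m i) * (if m == w then PZgX x (z i) else 1)).
  apply: eq_bigr => m _; case: ifP => mw; apply: eq_bigr => i _ //.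
  by rewrite PYE; apply: eq_bigr => x _; rewrite mulr1.
under [RHS]eq_bigr do rewrite bigA_distr_bigA /=.
rewrite bigA_distr_bigA /=; apply: eq_bigr => xs _.
under [RHS]eq_bigr do rewrite big_split /=.
rewrite big_split /=; congr (_ * _).
by rewrite (bigD1 w)//= eqxx [X in _ = _ * X]big1 ?mulr1// => m /negPf ->; rewrite big1.
Qed.

Lemma sum_joint_at n M (w : 'I_M) (z : {ffun 'I_n -> Z}) (F : {ffun 'I_n -> Y} -> R) :
  \sum_ys joint w ys z * F (ys w) = \sum_u PYZn u z * F u.
Proof.
pose G (m : 'I_M) u := if m == w then PYZn u z * F u else PYn u.
transitivity (\sum_(ys : {ffun 'I_M -> {ffun 'I_n -> Y}}) \prod_m G m (ys m)).
  apply: eq_bigr => ys _; rewrite /joint (bigD1 w)//= [RHS](bigD1 w)//= /G eqxx.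
  by rewrite mulrAC; congr (_ * _); apply: eq_bigr => m /negPf ->.
rewrite -bigA_distr_bigA (bigD1 w)//= /G eqxx [X in _ * X]big1 ?mulr1// => m /negPf ->.
exact: sum_PYn.
Qed.

(** A stored sequence other than the true one is independent of the observation, hence the product
    of marginals. *)
Lemma sum_joint_off n M (w m : 'I_M) (z : {ffun 'I_n -> Z}) (F : {ffun 'I_n -> Y} -> R) :
  m != w -> \sum_ys joint w ys z * F (ys m) = PZn z * \sum_u PYn u * F u.
Proof.
move=> mw.
pose G (k : 'I_M) u := if k == w then PYZn u z else
  if k == m then PYn u * F u else PYn u.
transitivity (\sum_(ys : {ffun 'I_M -> {ffun 'I_n -> Y}}) \prod_m G m (ys m)).
  apply: eq_bigr => ys _; rewrite /joint (bigD1 m)//= [RHS](bigD1 m)//= /G eqxx.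
  rewrite (negPf mw) mulrAC; congr (_ * _); apply: eq_bigr => k /negPf ->.
  by [].
rewrite -bigA_distr_bigA (bigD1 w)//= (bigD1 m)//= /G !eqxx (negPf mw).
rewrite [X in _ * (_ * X)]big1 ?mulr1.
  by congr (_ * _); exact: sum_PYZn_l.
by move=> k /andP[/negPf -> /negPf ->]; exact: sum_PYn.
Qed.

(* Probability that the likelihood ratio [PYZn / (PYn PZn)] of a true pair is at
   most [theta], stated without division. *)
Definition lr_cdf n (theta : R) : R :=
  \sum_(z : {ffun 'I_n -> Z}) \sum_(u : {ffun 'I_n -> Y})
    PYZn u z * (PYZn u z <= theta * (PYn u * PZn z))%R%:R.

(** Change of measure: where the ratio is at most [theta], the joint law is at most [theta] times
    the law making [z] independent of the database. Under that law [w] plays no part, so guessing it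
    succeeds with probability [1 / M]. *)
Lemma err_prob_ge n M (g : {ffun 'I_M -> {ffun 'I_n -> Y}} -> {ffun 'I_n -> Z} -> 'I_M)
    theta : (0 < M)%N -> 0 <= theta ->
  lr_cdf n theta - theta / M%:R <= err_prob PX PYgX PZgX g.
Proof.
move=> M0 th0; rewrite err_probE.
have Mn0 : M%:R != 0 :> R by rewrite pnatr_eq0 -lt0n.
pose A (ys : {ffun 'I_M -> {ffun 'I_n -> Y}}) (w : 'I_M) (z : {ffun 'I_n -> Z}) :=
  (PYZn (ys w) z <= theta * (PYn (ys w) * PZn z))%R.
have -> : lr_cdf n theta = M%:R^-1 *
    \sum_w \sum_z \sum_ys joint w ys z * (A ys w z)%:R.
  have H w : \sum_z \sum_ys joint w ys z * (A ys w z)%:R = lr_cdf n theta.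
    apply: eq_bigr => z _.
    exact: (sum_joint_at w z (fun u => (PYZn u z <= theta * (PYn u * PZn z))%R%:R)).
  under eq_bigr do rewrite H.
  by rewrite sumr_const card_ord -[X in _ * X]mulr_natl mulrA mulVf// mul1r.
rewrite (mulrC theta) -mulrBr ler_pM2l ?invr_gt0 ?ltr0n//.
rewrite lerBlDr -lerBlDl.
(* The total mass [theta] of the dominating measure, split according to the decoded index. *)
have -> : theta = \sum_z \sum_ys \sum_(w : 'I_M)
    (g ys z == w)%:R * (theta * PZn z * \prod_m PYn (ys m)).
  under eq_bigr do under eq_bigr do rewrite -mulr_suml.
  have H1 (k : 'I_M) : \sum_w (k == w)%:R = 1 :> R.
    by rewrite (bigD1 k)//= eqxx big1 ?addr0// => w; rewrite eq_sym => /negPf ->.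
  under eq_bigr do under eq_bigr do rewrite H1 mul1r.
  under eq_bigr do rewrite -mulr_sumr.
  rewrite -mulr_suml -mulr_sumr sum_PZn mulr1.
  rewrite -(bigA_distr_bigA (fun _ => @PYn n)) big1 ?mulr1// => m _.
  exact: sum_PYn.
rewrite -sumrB; under [leRHS]eq_bigr do rewrite exchange_big /=.
rewrite [leRHS]exchange_big /=.
apply: ler_sum => w _; rewrite -sumrB; apply: ler_sum => z _.
rewrite -sumrB; apply: ler_sum => ys _; rewrite -mulrBr.
have R0 : 0 <= theta * PZn z * \prod_m PYn (ys m).
  by rewrite !mulr_ge0 ?PZn_ge0// prodr_ge0// => m _; exact: PYn_ge0.
case: eqVneq => [_|_]; last first.
  rewrite mul0r mulr_ge0_le0 ?joint_ge0// subr_le0 lern1; by case: (A _ _ _).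
rewrite subr0 mul1r; have [Ah|_] := boolP (A ys w z); last by rewrite mulr0.
rewrite mulr1 /joint (bigD1 w)//= eqxx [X in _ <= _ * X](bigD1 w)//=.
rewrite (eq_bigr (fun m => PYn (ys m))); last by move=> m /negPf ->.
rewrite [leRHS]mulrA ler_wpM2r//.
  by apply: prodr_ge0 => m _; exact: PYn_ge0.
by apply: (le_trans Ah); rewrite -mulrA (mulrC (PZn z)).
Qed.

Lemma err_prob_le n M theta : (0 < M)%N -> 0 < theta ->
  exists g, err_prob PX PYgX PZgX (n := n) (M := M) g <= lr_cdf n theta + M%:R / theta.
Proof.
case: M => // M _ th0.
pose A u (z : {ffun 'I_n -> Z}) := (PYZn u z <= theta * (PYn u * PZn z))%R.
(* Any item passing the test is returned, with [ord0] as default. An error then requires that the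
   true item fails or that a wrong one passes. *)
pose g (ys : {ffun 'I_M.+1 -> {ffun 'I_n -> Y}}) z : 'I_M.+1 :=
  if [pick m | ~~ A (ys m) z] is Some m then m else ord0.
exists g; rewrite err_probE.
have gP ys z w : (g ys z != w)%:R <=
    (A (ys w) z)%:R + \sum_(m | m != w) (~~ A (ys m) z)%:R :> R.
  have S0 : 0 <= \sum_(m | m != w) (~~ A (ys m) z)%:R :> R by apply: sumr_ge0.
  rewrite /g; case: pickP => [m Am|noA].
    case: (eqVneq m w) => [_|mw]; first by rewrite addr_ge0.
    rewrite (bigD1 m)//= Am addrA (addrC _ 1) -addrA lerDl addr_ge0// sumr_ge0//.
  have := noA w; rewrite /= => /negbFE ->.
  by rewrite ler_wpDr//; case: (_ != _).
apply: (@le_trans _ _ (M.+1%:R^-1 * \sum_(w : 'I_M.+1) (lr_cdf n theta + M.+1%:R / theta))).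
  rewrite ler_pM2l ?invr_gt0 ?ltr0n//; apply: ler_sum => w _.
  apply: (@le_trans _ _ (\sum_z \sum_ys joint w ys z * (A (ys w) z)%:R +
     \sum_(m | m != w) \sum_z \sum_ys joint w ys z * (~~ A (ys m) z)%:R)).
    rewrite [X in _ + X]exchange_big /= -big_split /=; apply: ler_sum => z _.
    rewrite [X in _ + X]exchange_big /= -big_split /=; apply: ler_sum => ys _.
    rewrite -mulr_sumr -mulrDr ler_wpM2l ?joint_ge0//.
  apply: lerD.
    rewrite le_eqVlt; apply/orP; left; apply/eqP; apply: eq_bigr => z _.
    exact: (sum_joint_at w z (fun u => (A u z)%:R)).
  apply: (@le_trans _ _ (\sum_(m : 'I_M.+1 | m != w) theta^-1)); last first.
    rewrite sumr_const -[leLHS]mulr_natl ler_wpM2r ?invr_ge0 ?(ltW th0)// ler_nat.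
    by rewrite -[leqRHS](card_ord M.+1) max_card.
  apply: ler_sum => m mw.
  under eq_bigr do rewrite (sum_joint_off _ (fun u => (~~ A u _)%:R) mw) mulr_sumr.
  (* Where a wrong item passes, the product law is below [PYZn / theta], a measure of mass
     [theta^-1]. *)
  have -> : theta^-1 = \sum_(z : {ffun 'I_n -> Z}) \sum_u PYZn u z * theta^-1.
    by under eq_bigr do rewrite -mulr_suml; rewrite -mulr_suml sum_PYZn mul1r.
  apply: ler_sum => z _; apply: ler_sum => u _.
  rewrite mulrA (mulrC (PZn z)) ler_pdivlMr//.
  have [Ah|] := boolP (A u z); first by rewrite mulr0 mul0r PYZn_ge0.
  by rewrite mulr1 /A -ltNge [X in _ -> X <= _]mulrC => /ltW.
by rewrite sumr_const card_ord -[X in _ * X <= _]mulr_natl mulrA mulVf ?mul1r// pnatr_eq0.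
Qed.

End Coding.

(** * From likelihood ratios to sums of information densities *)

Section InformationSpectrum.
Variables (R : realType) (X Y Z : finType).
Variables (PX : X -> R) (PYgX : X -> Y -> R) (PZgX : X -> Z -> R).
Hypotheses (dX : is_dist PX) (dY : is_channel PYgX) (dZ : is_channel PZgX).

Local Notation pYZ := (PYZ PX PYgX PZgX).
Local Notation pY := (PY PX PYgX PZgX).
Local Notation pZ := (PZ PX PYgX PZgX).
Local Notation info := (info_dens PX PYgX PZgX).
Local Notation MI := (mutual_info PX PYgX PZgX).
Local Notation V := (dispersion PX PYgX PZgX).

Definition joint_pair (p : Y * Z) : R := pYZ p.1 p.2.

(** The value 0 off the support replaces the logarithm of a degenerate quotient and carries no
    mass. *)
Definition centered_info (p : Y * Z) : R :=
  if 0 < joint_pair p then info p.1 p.2 - MI else 0.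

Lemma joint_pair_dist : is_dist joint_pair.
Proof.
split=> [p|]; first exact: PYZ_ge0.
by rewrite -[RHS](sum_PY dX dY dZ) [RHS]pair_bigA; apply: eq_bigr.
Qed.

Lemma sum_joint_pair (F : Y * Z -> R) :
  \sum_p joint_pair p * F p = \sum_y \sum_(z | 0 < pYZ y z) pYZ y z * F (y, z).
Proof.
rewrite pair_big_dep /= [LHS](bigID (fun p => 0 < joint_pair p)) /=.
rewrite [X in _ + X]big1 ?addr0 => [|p]; first by apply: eq_bigr => -[].
rewrite -leNgt => p0; suff -> : joint_pair p = 0 by rewrite mul0r.
by apply/eqP; rewrite eq_le p0 PYZ_ge0.
Qed.

Lemma mean_centered_info : \sum_p joint_pair p * centered_info p = 0.
Proof.
transitivity (\sum_p joint_pair p * (info p.1 p.2 - MI)).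
  rewrite !sum_joint_pair; apply: eq_bigr => y _; apply: eq_bigr => z yz.
  by rewrite /centered_info /joint_pair /= yz.
under eq_bigr do rewrite mulrBr.
rewrite sumrB -mulr_suml (proj2 joint_pair_dist) mul1r sum_joint_pair.
by rewrite /MI subrr.
Qed.

Lemma var_centered_info : \sum_p joint_pair p * centered_info p ^+ 2 = V.
Proof.
rewrite sum_joint_pair; apply: eq_bigr => y _; apply: eq_bigr => z yz.
by rewrite /centered_info /joint_pair /= yz.
Qed.

Lemma PYZ_info y z : 0 < pYZ y z -> pYZ y z = pY y * pZ z * expR (info y z).
Proof.
move=> yz; have [y0 z0] := PYZ_gt0 dX dY dZ yz.
rewrite /info_dens lnK; first by rewrite /PZgY; field; rewrite !gt_eqF.
by rewrite posrE !divr_gt0.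
Qed.

Lemma lr_cdfE n (theta : R) : 0 < theta ->
  lr_cdf PX PYgX PZgX n theta =
  sum_cdf joint_pair centered_info n (ln theta - n%:R * MI).
Proof.
move=> th0; rewrite /lr_cdf /sum_cdf pair_big /=.
pose h (p : {ffun 'I_n -> Z} * {ffun 'I_n -> Y}) : {ffun 'I_n -> Y * Z} :=
  [ffun i => (p.2 i, p.1 i)].
rewrite [RHS](reindex h) /=; last first.
  exists (fun t => ([ffun i => (t i).2], [ffun i => (t i).1])).
    by move=> [z u] _; congr pair; apply/ffunP => i; rewrite !ffunE.
  by move=> t _; apply/ffunP => i; rewrite !ffunE /=; case: (t i).
apply: eq_bigr => -[z u] _ /=.
have -> : \prod_i joint_pair (h (z, u) i) = PYZn PX PYgX PZgX u z.
  by apply: eq_bigr => i _; rewrite ffunE.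
(* Strings of mass zero contribute nothing to either side; on the others every letter pair has
   positive mass, so logarithms are legitimate. *)
have [u0|] := ltP 0 (PYZn PX PYgX PZgX u z); last first.
  move=> u0; suff -> : PYZn PX PYgX PZgX u z = 0 by rewrite !mul0r.
  by apply/eqP; rewrite eq_le u0 PYZn_ge0.
have pos i : 0 < pYZ (u i) (z i).
  rewrite lt_neqAle PYZ_ge0// andbT eq_sym.
  by move: u0; rewrite lt_neqAle eq_sym => /andP[/prodf_neq0/(_ i isT)].
congr (_ * _%:R).
have -> : \sum_i centered_info (h (z, u) i) = \sum_i info (u i) (z i) - n%:R * MI.
  transitivity (\sum_(i < n) (info (u i) (z i) - MI)).
    by apply: eq_bigr => i _; rewrite /centered_info ffunE /joint_pair /= pos.
  by rewrite sumrB sumr_const card_ord mulr_natl.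
rewrite lerD2r.
have -> : PYZn PX PYgX PZgX u z =
    PYn PX PYgX PZgX u * PZn PX PYgX PZgX z * expR (\sum_i info (u i) (z i)).
  rewrite expR_sum -!big_split /=; apply: eq_bigr => i _; exact: PYZ_info.
have P0 : 0 < PYn PX PYgX PZgX u * PZn PX PYgX PZgX z.
  by rewrite mulr_gt0// prodr_gt0// => i _; case: (PYZ_gt0 dX dY dZ (pos i)).
rewrite mulrC ler_pM2r// -[in LHS](lnK (x := theta)) ?posrE// ler_expR//.
Qed.

Lemma achievable1 n eps : 0 <= eps -> achievable PX PYgX PZgX n eps 1.
Proof.
move=> e0; split=> //; exists (fun _ _ => ord0).
rewrite /err_prob big1// => xs _; rewrite big1// => ys _; rewrite big1// => w _.
by rewrite big1// => z _; rewrite [w]ord1 eqxx mulr0.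
Qed.

(** A threshold above every likelihood ratio makes [lr_cdf] equal to 1, and the converse becomes
    [1 - theta / M <= eps]. This bound ensures that the maximum defining [Mstar] exists. *)
Lemma achievable_bounded n eps : eps < 1 ->
  exists B : nat, forall M, achievable PX PYgX PZgX n eps M -> (M <= B)%N.
Proof.
move=> e1; pose c : R := \sum_(t : {ffun 'I_n -> Y * Z}) `|\sum_i centered_info (t i)|.
pose theta := expR (c + n%:R * MI); have th0 : 0 < theta by exact: expR_gt0.
have lr1 : lr_cdf PX PYgX PZgX n theta = 1.
  rewrite lr_cdfE// expRK addrK /sum_cdf.
  transitivity (\sum_(t : {ffun 'I_n -> Y * Z}) \prod_i joint_pair (t i)).
    apply: eq_bigr => t _.
    rewrite (_ : (_ <= c)%R = true) ?mulr1// (le_trans (ler_norm _))// /c.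
    by rewrite (bigD1 t)//= lerDl sumr_ge0.
  rewrite -(bigA_distr_bigA (fun _ => joint_pair)) big1// => i _.
  by case: joint_pair_dist.
exists (Num.truncn (theta / (1 - eps))).+1 => M [M0 [g ge]].
have := le_trans (err_prob_ge dX dY dZ g M0 (ltW th0)) ge; rewrite lr1.
have M0' : 0 < M%:R :> R by rewrite ltr0n.
rewrite lerBlDr -lerBlDl ler_pdivlMr// mulrC -ler_pdivlMr ?subr_gt0// => H.
rewrite -(ler_nat R); apply: (le_trans H).
by apply/ltW/truncnS_gt.
Qed.

Lemma Mstar_spec n eps : 0 <= eps < 1 ->
  let M := Mstar PX PYgX PZgX n eps in
  achievable PX PYgX PZgX n eps M /\
  forall M', achievable PX PYgX PZgX n eps M' -> (M' <= M)%N.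
Proof.
move=> /andP[e0 e1] /=; have [B HB] := achievable_bounded n e1.
have ex : exists M, `[< achievable PX PYgX PZgX n eps M >].
  by exists 1%N; apply/asboolP/achievable1.
have ub M : `[< achievable PX PYgX PZgX n eps M >] -> (M <= B)%N.
  by move=> /asboolP /HB.
case: (ex_maxnP ex ub) => M /asboolP HM Hmax.
apply: (@xgetI _ 0%N [set M | achievable PX PYgX PZgX n eps M /\
  forall M', achievable PX PYgX PZgX n eps M' -> (M' <= M)%N] M).
by split=> // M' /asboolP /Hmax.
Qed.

End InformationSpectrum.

(** * Terms negligible at scale [sqrt n] *)

Section Asymptotics.
Variable R : realType.

Lemma near_sqrt_ge (K : R) : \forall n \near \oo, K <= Num.sqrt n%:R.
Proof.
exists (Num.truncn (K ^+ 2)).+1 => // n /= Kn.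
apply: (le_trans (ler_norm K)); rewrite -sqrtr_sqr ler_wsqrtr//.
by apply: (le_trans (ltW (truncnS_gt _))); rewrite ler_nat.
Qed.

(** This absorbs the factor [sqrt n] of the thresholds, and the rounding of [M], into the slack.
    With [w] the square root of [sqrt n], [ln w <= w - 1] reduces the claim to [2 / c <= w]. *)
Lemma near_ln_sqrt_le (c : R) : 0 < c ->
  \forall n \near \oo, 1 + ln (Num.sqrt n%:R) <= c * Num.sqrt n%:R.
Proof.
move=> c0; near=> n; set s := Num.sqrt _.
have s1 : 1 <= s by rewrite /s; near: n; exact: near_sqrt_ge.
have sc : (2 / c) ^+ 2 <= s by rewrite /s; near: n; exact: near_sqrt_ge.
have s0 : 0 < s by exact: lt_le_trans s1.
pose w := Num.sqrt s; have w0 : 0 < w by rewrite sqrtr_gt0.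
have sw : s = w ^+ 2 by rewrite sqr_sqrtr ?ltW.
have wc : 2 / c <= w.
  rewrite -(ler_pXn2r (n := 2)) ?nnegrE ?(ltW w0) ?divr_ge0 ?(ltW c0)//.
  by rewrite -sw.
have lw : ln w <= w - 1.
  have := le_ln1Dx (x := w - 1).
  by rewrite [1 + _]addrC subrK; apply; rewrite ltrBrDr addrC subrr.
have -> : ln s = 2 * ln w by rewrite sw lnXn// mulr_natl.
move: wc; rewrite ler_pdivrMr// => wc; rewrite sw expr2 mulrA.
nra.
Unshelve. all: by end_near. Qed.

Lemma near_div_sqrt_le (K c : R) : 0 < c ->
  \forall n \near \oo, K / Num.sqrt n%:R <= c.
Proof.
move=> c0; near=> n; rewrite ler_pdivrMr; last first.
  by apply: (@lt_le_trans _ _ 1) => //; near: n; exact: near_sqrt_ge.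
rewrite mulrC -ler_pdivrMr//; near: n; exact: near_sqrt_ge.
Unshelve. all: by end_near. Qed.

End Asymptotics.

(** * The two directions at the second order *)

Section SecondOrder.
Variables (R : realType) (X Y Z : finType).
Variables (PX : X -> R) (PYgX : X -> Y -> R) (PZgX : X -> Z -> R) (eps : R).
Hypotheses (dX : is_dist PX) (dY : is_channel PYgX) (dZ : is_channel PZgX).
Hypothesis V0 : 0 < dispersion PX PYgX PZgX.
Hypothesis eps01 : 0 < eps < 1.

Local Notation MI := (mutual_info PX PYgX PZgX).
Local Notation sigma := (Num.sqrt (dispersion PX PYgX PZgX)).
Local Notation t := (PhiInv eps).
Local Notation logM n := (ln (Mstar PX PYgX PZgX n eps)%:R).

Let s0 : 0 < sigma. Proof. by rewrite sqrtr_gt0. Qed.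
Let dQ := joint_pair_dist dX dY dZ.
Let m0 := mean_centered_info dX dY dZ.
Let v0 : \sum_p joint_pair PX PYgX PZgX p * centered_info PX PYgX PZgX p ^+ 2 = sigma ^+ 2.
Proof. by rewrite var_centered_info// sqr_sqrtr ?ltW. Qed.
Let e01 : 0 <= eps < 1. Proof. by case/andP: eps01 => /ltW -> ->. Qed.

(** The slack is spent in thirds: one keeps [Phi (t + d / 3)] strictly above [eps], one is the gap
    of the central limit theorem, and one pays for [ln (sqrt n)]. *)
Lemma second_order_converse d : 0 < d ->
  \forall n \near \oo, logM n - n%:R * MI <= sigma * (t + d) * Num.sqrt n%:R.
Proof.
move=> d0; have td : t + d / 3 < t + d / 3 * 2 by lra.
have [C HC] := clt_lower dQ s0 m0 v0 td.
have gap : 0 < (Phi (t + d / 3) - eps) / 2.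
  by rewrite divr_gt0// subr_gt0 -{1}(PhiInvK eps01) Phi_increasing//; lra.
have sd : 0 < sigma * (d / 3) by rewrite mulr_gt0//; lra.
near=> n.
have n0 : (0 < n)%N by near: n; exists 1%N.
have q0 : 0 < Num.sqrt n%:R :> R by rewrite sqrtr_gt0 ltr0n.
have [[M0 [g ge]] _] := Mstar_spec dX dY dZ n e01.
rewrite leNgt; apply/negP => big.
set q := Num.sqrt _ in q0 big; set M := Mstar _ _ _ _ _ in M0 g ge big.
have M0' : 0 < M%:R :> R by rewrite ltr0n.
have thE : M%:R / q / M%:R = q^-1 by field; rewrite !gt_eqF.
have th0 : 0 < M%:R / q by rewrite divr_gt0.
have := le_trans (err_prob_ge dX dY dZ g M0 (ltW th0)) ge.
rewrite thE lr_cdfE// ln_div ?posrE//.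
have lq : 1 + ln q <= sigma * (d / 3) * q.
  by rewrite /q; near: n; exact: near_ln_sqrt_le.
have le1 : (t + d / 3 * 2) * (sigma * q) <= ln M%:R - ln q - n%:R * MI by lra.
have := le_sum_cdf (centered_info PX PYgX PZgX) dQ n le1.
have := HC n n0; rewrite -/q.
have : C / q <= (Phi (t + d / 3) - eps) / 2 / 2.
  by rewrite /q; near: n; apply: near_div_sqrt_le; lra.
have : 1 / q < (Phi (t + d / 3) - eps) / 2.
  apply: (@le_lt_trans _ _ ((Phi (t + d / 3) - eps) / 2 / 2)); last lra.
  by rewrite /q; near: n; apply: near_div_sqrt_le; lra.
rewrite div1r; lra.
Unshelve. all: by end_near. Qed.

Lemma second_order_achievability d : 0 < d ->
  \forall n \near \oo, sigma * (t - d) * Num.sqrt n%:R <= logM n - n%:R * MI.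
Proof.
move=> d0; have td : t - d / 3 * 2 < t - d / 3 by lra.
have [C HC] := clt_upper dQ s0 m0 v0 td.
have gap : 0 < (eps - Phi (t - d / 3)) / 2.
  by rewrite divr_gt0// subr_gt0 -[ltRHS](PhiInvK eps01) Phi_increasing//; lra.
have sd : 0 < sigma * (d / 3) by rewrite mulr_gt0//; lra.
near=> n.
have n0 : (0 < n)%N by near: n; exists 1%N.
have q0 : 0 < Num.sqrt n%:R :> R by rewrite sqrtr_gt0 ltr0n.
have [_ max] := Mstar_spec dX dY dZ n e01.
set q := Num.sqrt _ in q0 *.
pose e := n%:R * MI + sigma * (t - d) * q.
suff [M HM lM] : exists2 M, achievable PX PYgX PZgX n eps M & e <= ln M%:R.
  rewrite lerBrDl; apply: (le_trans lM).
  have M0 := HM.1.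
  by rewrite ler_ln ?posrE ?ltr0n ?ler_nat ?(leq_trans M0) ?max.
(* A nonpositive target is met by a single item. A positive one gives [1 <= expR e], so rounding up
   at most doubles [expR e] and raises the logarithm by at most 1. *)
have [e0|e0] := leP e 0.
  by exists 1%N; [case/andP: eps01 => /ltW h _; exact: achievable1|rewrite ln1].
pose M := (Num.truncn (expR e)).+1.
have M0' : 0 < M%:R :> R by rewrite ltr0n.
have eM : expR e <= M%:R by exact/ltW/truncnS_gt.
have lM : e <= ln M%:R by rewrite -[leLHS]expRK ler_ln ?posrE ?expR_gt0.
exists M => //; split=> //.
have lM2 : ln M%:R <= e + 1.
  rewrite -[leRHS]expRK ler_ln ?posrE ?expR_gt0// expRD.
  have E1 : 1 <= expR e by rewrite -expR0 ler_expR ltW.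
  have e2 : 2 <= expR (1 : R) by have := expR_ge1Dx (1 : R); lra.
  have : M%:R <= expR e + 1 by rewrite -natr1 lerD2r truncn_le ltW ?expR_gt0.
  nra.
have th0 : 0 < M%:R * q by rewrite mulr_gt0.
have [g Hg] := err_prob_le dX dY dZ n (ltn0Sn _ : (0 < M)%N) th0.
exists g; apply: (le_trans Hg).
have -> : M%:R / (M%:R * q) = q^-1 by field; rewrite !gt_eqF.
rewrite lr_cdfE// lnM ?posrE//.
have lq : 1 + ln q <= sigma * (d / 3) * q.
  by rewrite /q; near: n; exact: near_ln_sqrt_le.
have le1 : ln M%:R + ln q - n%:R * MI <= (t - d / 3 * 2) * (sigma * q).
  by rewrite /e in lM2; lra.
have := le_sum_cdf (centered_info PX PYgX PZgX) dQ n le1.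
have := HC n n0; rewrite -/q.
have : C / q <= (eps - Phi (t - d / 3)) / 2.
  by rewrite /q; near: n; apply: near_div_sqrt_le.
have : 1 / q <= (eps - Phi (t - d / 3)) / 2.
  by rewrite /q; near: n; apply: near_div_sqrt_le.
rewrite div1r; lra.
Unshelve. all: by end_near. Qed.

End SecondOrder.

Theorem theorem8 (R : realType) (X Y Z : finType)
  (PX : X -> R) (PYgX : X -> Y -> R) (PZgX : X -> Z -> R) (eps : R) :
  is_dist PX -> is_channel PYgX -> is_channel PZgX ->
  0 < dispersion PX PYgX PZgX ->
  0 < eps < 1 ->
  Lstar PX PYgX PZgX eps
  = (Num.sqrt (dispersion PX PYgX PZgX) * PhiInv eps)%:E.
Proof.
move=> dX dY dZ V0 eps01; rewrite /Lstar.
have s0 : 0 < Num.sqrt (dispersion PX PYgX PZgX) by rewrite sqrtr_gt0.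
(* The two directions sandwich the sequence for all large [n], so it converges and its lower limit
   is the limit. *)
apply: (fun u l cu => (@cvg_limn_einf_sup R u l cu).1).
apply: cvg_EFin; first exact: nearW.
apply/cvgrPdist_le => /= e e0.
pose d := e / Num.sqrt (dispersion PX PYgX PZgX).
have d0 : 0 < d by rewrite divr_gt0.
have sd : Num.sqrt (dispersion PX PYgX PZgX) * d = e by rewrite mulrC divfK// gt_eqF.
near=> n.
have q0 : 0 < Num.sqrt n%:R :> R by rewrite sqrtr_gt0 ltr0n; near: n; exists 1%N.
have : Num.sqrt (dispersion PX PYgX PZgX) * (PhiInv eps - d) * Num.sqrt n%:R <=
    ln (Mstar PX PYgX PZgX n eps)%:R - n%:R * mutual_info PX PYgX PZgX.
  by near: n; exact: second_order_achievability.
have : ln (Mstar PX PYgX PZgX n eps)%:R - n%:R * mutual_info PX PYgX PZgX <=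
    Num.sqrt (dispersion PX PYgX PZgX) * (PhiInv eps + d) * Num.sqrt n%:R.
  by near: n; exact: second_order_converse.
rewrite -(ler_pdivrMr _ _ q0) -(ler_pdivlMr _ _ q0).
by rewrite mulrDr mulrBr sd ler_norml; lra.
Unshelve. all: by end_near. Qed.
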